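(* Let $x_k\in\mathbb{R}^n$. If $M>0$, then $$\theta^*:=\min_{x\in\mathbb{R}^n}\max_{\|u\|\le 1}\theta_k(x,u)=\max_{(u,w)\in\mathcal{F}_k}\beta_k(u,w)=\beta^*.$$ For any $(u,w)\in\mathcal{F}_k$, the point $x_{k+1}=x_k-H_k(u,w)^{-1}G_k(u)$, with $r_k=\|x_{k+1}-x_k\|$, satisfies $$0\le\theta_k(x_{k+1},u)-\beta_k(u,w)=\frac{M}{12}\left(\frac wM+2r_k\right)\left(r_k-\frac wM\right)^2.$$
   Context: Setting: the problem $\min_{x\in\mathbb{R}^n}\|F(x)\|+h(x)$, with $F=(F_1,\dots,F_m):\mathbb{R}^n\to\mathbb{R}^m$, each $F_i$ twice differentiable with Lipschitz continuous second derivative, $\|\cdot\|$ the Euclidean norm, and $h(x)=\frac12x^TBx+\langle a,x\rangle$ a convex quadratic ($B\in\mathbb{R}^{n\times n}$ symmetric positive semidefinite, $a\in\mathbb{R}^n$). For the current point $x_k$, $u=(u_1,\dots,u_m)\in\mathbb{R}^m$ and $w\ge 0$, define - $H_k(u,w)=\sum_{i=1}^mu_i\nabla^2F_i(x_k)+B+\frac w2I_n$; - $G_k(u)=\sum_{i=1}^mu_i\nabla F_i(x_k)+a+Bx_k$; - $l_k(u)=\sum_{i=1}^mu_iF_i(x_k)$; - $\theta_k(x,u)=l_k(u)+\langle G_k(u),x-x_k\rangle+\frac12\left\langle\left(\sum_{i=1}^mu_i\nabla^2F_i(x_k)+B\right)(x-x_k),x-x_k\right\rangle+\frac M6\|x-x_k\|^3$;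 - $\beta_k(u,w)=l_k(u)-\frac12\left\langle H_k(u,w)^{-1}G_k(u),G_k(u)\right\rangle-\frac1{12M^2}w^3$; - $\mathcal{F}_k=\left\{(u,w)\in\mathbb{R}^m\times\mathbb{R}_+:\ \|u\|\le 1,\ \sum_{i=1}^mu_i\nabla^2F_i(x_k)+B+\frac w2I_n\succ 0\right\}$. The quantity $\beta^*$ is $\max_{(u,w)\in\mathcal{F}_k}\beta_k(u,w)$.
   Formalization: The equality of the min-max with the maximum of β_k over F_k is stated under the condition that this maximum is attained; without it the claim fails, e.g. F(x)=(10(x²−1),5x), B=0, a=0, x_k=0, M=1 gives θ*>4.8 but sup β_k=1/6. *)

(* Defs.v *)
From HB Require Import structures.
From mathcomp Require Import all_boot all_order all_algebra.
From mathcomp Require Import all_classical all_reals all_analysis.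

Set Implicit Arguments.
Unset Strict Implicit.
Unset Printing Implicit Defensive.

Import Order.TTheory GRing.Theory Num.Theory.
Import numFieldNormedType.Exports.

Local Open Scope classical_set_scope.
Local Open Scope ring_scope.

Definition dot (R : realType) (n : nat) (x y : 'cV[R]_n) : R :=
  \sum_(i < n) x i 0 * y i 0.

(* The norm `|x| that the library puts on matrices is the max norm. *)
Definition enorm (R : realType) (n : nat) (x : 'cV[R]_n) : R :=
  Num.sqrt (dot x x).

Definition psdmx (R : realType) (n : nat) (A : 'M[R]_n) : Prop :=
  forall v : 'cV[R]_n, 0 <= dot (A *m v) v.

Definition pdmx (R : realType) (n : nat) (A : 'M[R]_n) : Prop :=
  forall v : 'cV[R]_n, v != 0 -> 0 < dot (A *m v) v.

Definition basis_vec (R : realType) (n : nat) (i : 'I_n) : 'cV[R]_n :=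
  delta_mx i 0.

Definition grad (R : realType) (n : nat) (f : 'cV[R]_n -> R)
    (x : 'cV[R]_n) : 'cV[R]_n :=
  \col_(i < n) 'D_(basis_vec R i) f x.

Definition hess (R : realType) (n : nat) (f : 'cV[R]_n -> R)
    (x : 'cV[R]_n) : 'M[R]_n :=
  \matrix_(i < n, j < n)
    'D_(basis_vec R j) (fun y => 'D_(basis_vec R i) f y) x.

Definition twice_differentiable (R : realType) (n : nat)
    (f : 'cV[R]_n -> R) : Prop :=
  (forall x, differentiable f x) /\ (forall x, differentiable (grad f) x).

(* Lipschitz continuity is with respect to the max norms on vectors and
   matrices; up to the value of the constant, which is not recorded here, this
   is Lipschitz continuity for the Euclidean and the spectral norms. *)
Definition lipschitz_hess (R : realType) (n : nat)
    (f : 'cV[R]_n -> R) : Prop :=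
  [lipschitz hess f x | x in [set: 'cV[R]_n]].

Definition component (R : realType) (n m : nat) (F : 'cV[R]_n -> 'cV[R]_m)
    (i : 'I_m) : 'cV[R]_n -> R :=
  fun x => F x i 0.

(* [is_maximum S f v]: the maximum of f over S exists (it is attained) and its
   value is v; it is stronger than [v = sup (f @` S)]. *)
Definition is_maximum (R : realType) (T : Type) (S : set T) (f : T -> R)
    (v : R) : Prop :=
  (f @` S) v /\ ubound (f @` S) v.

Definition is_minimum (R : realType) (T : Type) (S : set T) (f : T -> R)
    (v : R) : Prop :=
  (f @` S) v /\ lbound (f @` S) v.

(* v = min_(x in X) max_(u in U) f x u, with all extrema attained. *)
Definition is_minmax (R : realType) (T1 T2 : Type) (X : set T1) (U : set T2)
    (f : T1 -> T2 -> R) (v : R) : Prop :=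
  exists phi : T1 -> R,
    (forall x, X x -> is_maximum U (f x) (phi x)) /\ is_minimum X phi v.

(* \sum_i u_i \nabla^2 F_i(xk) + B *)
Definition Ak (R : realType) (n m : nat) (F : 'cV[R]_n -> 'cV[R]_m)
    (B : 'M[R]_n) (xk : 'cV[R]_n) (u : 'cV[R]_m) : 'M[R]_n :=
  \sum_(i < m) u i 0 *: hess (component F i) xk + B.

Definition Hk (R : realType) (n m : nat) (F : 'cV[R]_n -> 'cV[R]_m)
    (B : 'M[R]_n) (xk : 'cV[R]_n) (u : 'cV[R]_m) (w : R) : 'M[R]_n :=
  Ak F B xk u + (w / 2)%:M.

Definition Gk (R : realType) (n m : nat) (F : 'cV[R]_n -> 'cV[R]_m)
    (B : 'M[R]_n) (a xk : 'cV[R]_n) (u : 'cV[R]_m) : 'cV[R]_n :=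
  \sum_(i < m) u i 0 *: grad (component F i) xk + a + B *m xk.

Definition lk (R : realType) (n m : nat) (F : 'cV[R]_n -> 'cV[R]_m)
    (xk : 'cV[R]_n) (u : 'cV[R]_m) : R :=
  \sum_(i < m) u i 0 * component F i xk.

Definition thetak (R : realType) (n m : nat) (F : 'cV[R]_n -> 'cV[R]_m)
    (B : 'M[R]_n) (a : 'cV[R]_n) (M : R) (xk x : 'cV[R]_n)
    (u : 'cV[R]_m) : R :=
  lk F xk u + dot (Gk F B a xk u) (x - xk)
  + 1 / 2 * dot (Ak F B xk u *m (x - xk)) (x - xk)
  + M / 6 * enorm (x - xk) ^+ 3.

Definition betak (R : realType) (n m : nat) (F : 'cV[R]_n -> 'cV[R]_m)
    (B : 'M[R]_n) (a : 'cV[R]_n) (M : R) (xk : 'cV[R]_n)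
    (u : 'cV[R]_m) (w : R) : R :=
  lk F xk u
  - 1 / 2 * dot (invmx (Hk F B xk u w) *m Gk F B a xk u) (Gk F B a xk u)
  - 1 / (12 * M ^+ 2) * w ^+ 3.

Definition Fk (R : realType) (n m : nat) (F : 'cV[R]_n -> 'cV[R]_m)
    (B : 'M[R]_n) (xk : 'cV[R]_n) : set ('cV[R]_m * R) :=
  [set p | [/\ 0 <= p.2, enorm p.1 <= 1 & pdmx (Hk F B xk p.1 p.2)]].

(* Main.v *)
(* With d = x - x_k and r = |d|, the elementary inequality
   M/6 r^3 >= w/4 r^2 - w^3/(12 M^2) (equality iff r = w/M, for w >= 0) gives a
   Lagrangian L(u,w,d) <= theta_k(x_k + d, u) that is quadratic in d, with Hessian
   H_k(u,w) and minimum value beta_k(u,w) over d, and affine in u; hence weak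
   duality and the gap formula.  Minimality of the critical point uses
   the symmetry of the Hessians, i.e. the equality of mixed derivatives.
   Conversely, if beta_k is maximal over F_k at (u,w) and d is the corresponding
   minimizer, an envelope argument along segments of F_k yields first-order
   conditions: in w they force |d| = w/M, so there is no gap, and in u they say
   that u maximizes theta_k(x_k + d, .) over the unit ball.  Then x_k + d
   attains the value beta_k(u,w).  The outer minimum exists by coercivity. *)

Require Import Defs.
From HB Require Import structures.
From mathcomp Require Import all_boot all_order all_algebra.
From mathcomp Require Import all_classical all_reals all_analysis.
From mathcomp Require Import ring lra.

Set Implicit Arguments.
Unset Strict Implicit.
Unset Printing Implicit Defensive.

Import Order.TTheory GRing.Theory Num.Theory.
Import numFieldNormedType.Exports.

Local Open Scope classical_set_scope.
Local Open Scope ring_scope.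

(** * Euclidean geometry and quadratic forms *)

Section DotProduct.
Context {R : realType}.
Implicit Types (n : nat) (t : R).

Lemma dotE n (x y : 'cV[R]_n) : dot x y = (x^T *m y) 0 0.
Proof. by rewrite mxE; apply: eq_bigr => i _; rewrite mxE. Qed.

Lemma dotC n (x y : 'cV[R]_n) : dot x y = dot y x.
Proof. by apply: eq_bigr => i _; rewrite mulrC. Qed.

Lemma dotDl n (x y z : 'cV[R]_n) : dot (x + y) z = dot x z + dot y z.
Proof. by rewrite !dotE linearD/= mulmxDl mxE. Qed.

Lemma dotZl n t (x y : 'cV[R]_n) : dot (t *: x) y = t * dot x y.
Proof. by rewrite !dotE linearZ/= -scalemxAl mxE. Qed.

Lemma dotDr n (x y z : 'cV[R]_n) : dot x (y + z) = dot x y + dot x z.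
Proof. by rewrite dotC dotDl !(dotC x). Qed.

Lemma dotZr n t (x y : 'cV[R]_n) : dot x (t *: y) = t * dot x y.
Proof. by rewrite dotC dotZl dotC. Qed.

Lemma dotNl n (x y : 'cV[R]_n) : dot (- x) y = - dot x y.
Proof. by rewrite -scaleN1r dotZl mulN1r. Qed.

Lemma dotNr n (x y : 'cV[R]_n) : dot x (- y) = - dot x y.
Proof. by rewrite dotC dotNl dotC. Qed.

Lemma dot0l n (x : 'cV[R]_n) : dot 0 x = 0.
Proof. by rewrite -(scale0r x) dotZl mul0r. Qed.

Lemma dot0r n (x : 'cV[R]_n) : dot x 0 = 0.
Proof. by rewrite dotC dot0l. Qed.

Lemma dot_suml n (I : finType) (f : I -> 'cV[R]_n) (y : 'cV[R]_n) :
  dot (\sum_i f i) y = \sum_i dot (f i) y.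
Proof.
by apply: (big_morph (fun x => dot x y)) => [x z|]; rewrite ?dotDl ?dot0l.
Qed.

Lemma dot_mulmx n (A : 'M[R]_n) (x y : 'cV[R]_n) :
  dot (A *m x) y = dot x (A^T *m y).
Proof. by rewrite !dotE trmx_mul mulmxA. Qed.

Lemma dot_ge0 n (x : 'cV[R]_n) : 0 <= dot x x.
Proof. by apply: sumr_ge0 => i _; rewrite -expr2 sqr_ge0. Qed.

Lemma dot_eq0 n (x : 'cV[R]_n) : (dot x x == 0) = (x == 0).
Proof.
apply/eqP/eqP => [|->]; last by rewrite dot0l.
move/eqP; rewrite psumr_eq0 => [/allP x0|i _]; last by rewrite -expr2 sqr_ge0.
apply/colP => i; rewrite mxE; apply/eqP.
by have := x0 i (mem_index_enum i); rewrite -expr2 sqrf_eq0.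
Qed.

Lemma enorm_ge0 n (x : 'cV[R]_n) : 0 <= enorm x.
Proof. exact: sqrtr_ge0. Qed.

Lemma sqr_enorm n (x : 'cV[R]_n) : enorm x ^+ 2 = dot x x.
Proof. by rewrite sqr_sqrtr ?dot_ge0. Qed.

Lemma enorm0 n : enorm (0 : 'cV[R]_n) = 0.
Proof. by rewrite /enorm dot0l sqrtr0. Qed.

Lemma enorm_eq0 n (x : 'cV[R]_n) : (enorm x == 0) = (x == 0).
Proof. by rewrite -dot_eq0 -sqr_enorm sqrf_eq0. Qed.

Lemma enormN n (x : 'cV[R]_n) : enorm (- x) = enorm x.
Proof. by rewrite /enorm dotNl dotNr opprK. Qed.

Lemma enorm_le n (x : 'cV[R]_n) t : 0 <= t -> (enorm x <= t) = (dot x x <= t ^+ 2).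
Proof.
by move=> t0; rewrite -sqr_enorm ler_pXn2r// nnegrE// enorm_ge0.
Qed.

Lemma entry_le_enorm n (x : 'cV[R]_n) i : `|x i 0| <= enorm x.
Proof.
rewrite -(ler_pXn2r (_ : 0 < 2)%N)// ?nnegrE ?normr_ge0 ?enorm_ge0//.
rewrite sqr_enorm real_normK ?num_real// /dot (bigD1 i)//= -expr2 lerDl.
by apply: sumr_ge0 => j _; rewrite -expr2 sqr_ge0.
Qed.

Lemma discriminant_le0 (p q r : R) :
  0 <= r -> (forall t, 0 <= p + 2 * t * q + t ^+ 2 * r) -> q ^+ 2 <= p * r.
Proof.
move=> r0 pqr0; have [r_eq0|rN0] := eqVneq r 0; last first.
  have := pqr0 (- (q / r)).
  have -> : p + 2 * - (q / r) * q + (- (q / r)) ^+ 2 * r = (p * r - q ^+ 2) / r.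
    by field.
  by rewrite pmulr_lge0 ?subr_ge0// invr_gt0 lt0r rN0.
have [->|qN0] := eqVneq q 0; first by rewrite r_eq0 expr0n/= mulr0.
(* With r = 0 the polynomial is affine, and at this t it takes the value -1. *)
have := pqr0 (- ((p + 1) / (2 * q))).
have -> : 2 * - ((p + 1) / (2 * q)) * q = - (p + 1) by field.
by rewrite r_eq0; lra.
Qed.

(** The polynomial t -> <A(x + ty), x + ty> is nonnegative, and symmetry of A makes its middle
    coefficient 2<Ax, y>; the bound is its discriminant condition. *)
Lemma psdmx_cauchy_schwarz n (A : 'M[R]_n) (x y : 'cV[R]_n) :
  A^T = A -> psdmx A ->
  dot (A *m x) y ^+ 2 <= dot (A *m x) x * dot (A *m y) y.
Proof.
move=> Asym Apsd; apply: discriminant_le0 => // t.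
have := Apsd (x + t *: y).
rewrite mulmxDr -scalemxAr !dotDl !dotDr !dotZl !dotZr.
have -> : dot (A *m y) x = dot (A *m x) y by rewrite dot_mulmx Asym dotC.
move=> /le_trans; apply; rewrite le_eqVlt; apply/orP; left; apply/eqP; ring.
Qed.

Lemma cauchy_schwarz n (x y : 'cV[R]_n) : dot x y <= enorm x * enorm y.
Proof.
apply: le_trans (ler_norm _) _.
rewrite -(@ler_pXn2r _ 2)// ?nnegrE ?mulr_ge0 ?enorm_ge0//.
rewrite real_normK ?num_real// exprMn !sqr_enorm.
have := @psdmx_cauchy_schwarz _ 1%:M x y (trmx1 _ _).
by rewrite !mul1mx; apply => v; rewrite mul1mx dot_ge0.
Qed.

(** Completing the square: the right side minus the left side is (e/4)|y + (2t/e)x|^2. *)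
Lemma young_dot n t (x y : 'cV[R]_n) (e : R) : 0 < e ->
  - (t ^+ 2 * (dot x x / e)) <= t * dot x y + e / 4 * dot y y.
Proof.
move=> e0; rewrite -subr_ge0.
have e4 : 0 <= e / 4 by rewrite divr_ge0// ltW.
have := mulr_ge0 e4 (dot_ge0 (y + (2 * t / e) *: x)).
rewrite !dotDl !dotDr !dotZl !dotZr (dotC y x) => h; apply: le_trans h _.
by rewrite le_eqVlt; apply/orP; left; apply/eqP; field; rewrite gt_eqF.
Qed.

Lemma enorm_convex_le1 n (x y : 'cV[R]_n) t :
  enorm x <= 1 -> enorm y <= 1 -> 0 <= t <= 1 ->
  enorm ((1 - t) *: x + t *: y) <= 1.
Proof.
move=> x1 y1 /andP[t0 t1].
have xy1 : dot x y <= 1.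
  by apply: le_trans (cauchy_schwarz _ _) _; rewrite mulr_ile1 ?enorm_ge0.
move: x1 y1; rewrite !enorm_le// !dotDl !dotDr !dotZl !dotZr (dotC y x) expr1n.
move: (dot x x) (dot x y) (dot y y) xy1 => p q r q1 p1 r1.
(* Writing 1 as ((1 - t) + t)^2 allows a comparison term by term. *)
have -> : 1 = (1 - t) ^+ 2 + 2 * (t * (1 - t)) + t ^+ 2 :> R by ring.
have : (1 - t) ^+ 2 * p <= (1 - t) ^+ 2 by rewrite ler_piMr ?sqr_ge0.
have : t ^+ 2 * r <= t ^+ 2 by rewrite ler_piMr ?sqr_ge0.
have : (t * (1 - t)) * q <= t * (1 - t) by rewrite ler_piMr ?mulr_ge0 ?subr_ge0.
by lra.
Qed.

Lemma quadform_bound n (A : 'M[R]_n) :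
  exists2 k, 0 <= k & forall x : 'cV[R]_n, `|dot (A *m x) x| <= k * dot x x.
Proof.
(* Each |x_i||x_j| is at most |x|^2, so the sum of the |A_ij| serves as the constant. *)
exists (\sum_i \sum_j `|A i j|) => [|x].
  by apply: sumr_ge0 => i _; apply: sumr_ge0.
rewrite /dot mulr_suml; apply: le_trans (ler_norm_sum _ _ _) _.
apply: ler_sum => i _; rewrite mxE !mulr_suml.
apply: le_trans (ler_norm_sum _ _ _) _; apply: ler_sum => j _.
rewrite -mulrA normrM ler_wpM2l// normrM -/(dot x x) -sqr_enorm expr2.
by apply: ler_pM => //; exact: entry_le_enorm.
Qed.

Lemma pdmx_psdmx n (A : 'M[R]_n) : pdmx A -> psdmx A.
Proof.
move=> Apd v; have [->|/Apd/ltW//] := eqVneq v 0.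
by rewrite mulmx0 dot0l.
Qed.

Lemma pdmx_unit n (A : 'M[R]_n) : pdmx A -> A \in unitmx.
Proof.
move=> Apd; rewrite -unitmx_tr -row_free_unit -kermx_eq0.
apply/rowV0P => v /sub_kermxP vA0; apply/eqP; rewrite -[_ == 0]negbK.
apply/negP => vN0.
have /Apd : v^T != 0 by rewrite -(inj_eq (@trmx_inj _ _ _)) trmxK trmx0.
by rewrite -[A *m _]trmxK trmx_mul trmxK vA0 trmx0 dot0l ltxx.
Qed.

(* Cauchy-Schwarz for the form of A, applied to v and A^-1 v, gives
   |v|^4 <= <A v, v> <A^-1 v, v>. *)
Lemma pdmx_coercive n (A : 'M[R]_n) : A^T = A -> pdmx A ->
  exists2 e, 0 < e & forall v : 'cV[R]_n, e * dot v v <= dot (A *m v) v.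
Proof.
move=> Asym Apd; have [k k0 kA] := quadform_bound (invmx A).
have k10 : 0 < k + 1 by rewrite ltr_wpDl.
exists (k + 1)^-1 => [|v]; first by rewrite invr_gt0.
rewrite ler_pdivrMl//.
have Au := pdmx_unit Apd.
have := psdmx_cauchy_schwarz (invmx A *m v) v Asym (pdmx_psdmx Apd).
rewrite mulKVmx// (dotC v) => cs.
have := kA v; rewrite ler_norml => /andP[_ kv].
have [->|vN0] := eqVneq v 0; first by rewrite mulmx0 dot0l mulr0.
have vv0 : 0 < dot v v by rewrite lt0r dot_eq0 vN0 dot_ge0.
have vAv0 : 0 < dot (A *m v) v by exact: Apd.
rewrite -(ler_pM2l vv0) -expr2; apply: le_trans cs _.
rewrite mulrA ler_pM2r// mulrC; apply: le_trans kv _.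
by rewrite ler_pM2r// lerDl.
Qed.

End DotProduct.

(** * Symmetry of the Hessian *)

Lemma derive_along_line (R : realType) (V : normedModType R) (f : V -> R)
    (x v : V) (t : R) :
  derivable f (x + t *: v) v ->
  is_derive t (1 : R) (fun s : R => f (x + s *: v)) ('D_v f (x + t *: v)).
Proof.
move=> df.
have slopeE : (fun h : R => h^-1 *: (f (x + (h *: 1 + t) *: v) - f (x + t *: v)))
  = (fun h : R => h^-1 *: (f (h *: v + (x + t *: v)) - f (x + t *: v))).
  apply/funext => h; congr (_ *: (f _ - _)).
  by rewrite [h *: 1]mulr1 scalerDl addrCA.
apply: DeriveDef; first by rewrite /derivable /= slopeE.
by rewrite /derive /= slopeE.
Qed.

Lemma MVT_along_line (R : realType) (V : normedModType R) (f : V -> R)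
    (x v : V) (s : R) :
  0 < s -> (forall y, derivable f y v) ->
  exists2 c, 0 < c < s & f (x + s *: v) - f x = s * 'D_v f (x + c *: v).
Proof.
move=> s0 df.
have dg t : is_derive t (1 : R) (fun r : R => f (x + r *: v))
              ('D_v f (x + t *: v)) by exact: derive_along_line.
have [|c] := @MVT _ (fun r : R => f (x + r *: v))
  (fun t => 'D_v f (x + t *: v)) 0 s s0 => //.
  by apply: derivable_within_continuous => t _; apply: ex_derive.
rewrite in_itv/= scale0r addr0 subr0 => cs ->.
by exists c => //; rewrite mulrC.
Qed.

(** The mean value theorem is applied twice: along u to g(y) = f(y + sv) - f(y), whose increment is
    the second difference, then along v to the derivative of f in direction u. *)
Lemma second_difference_MVT (R : realType) (V : normedModType R) (f : V -> R)
    (x u v : V) (s : R) :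
  0 < s -> (forall y, derivable f y u) ->
  (forall y, derivable (fun z => 'D_u f z) y v) ->
  exists c d, [/\ 0 < c < s, 0 < d < s &
    f (x + s *: u + s *: v) - f (x + s *: u) - f (x + s *: v) + f x
      = s ^+ 2 * 'D_v (fun z => 'D_u f z) (x + (c *: u + d *: v))].
Proof.
move=> s0 df ddf.
pose g := (fun y => f (y + s *: v)) - f.
have dshift y : derivable (fun y => f (y + s *: v)) y u /\
    'D_u (fun y => f (y + s *: v)) y = 'D_u f (y + s *: v).
  have E : (fun h : R => h^-1 *: (f (h *: u + y + s *: v) - f (y + s *: v)))
    = (fun h : R => h^-1 *: (f (h *: u + (y + s *: v)) - f (y + s *: v))).
    by apply/funext => h; rewrite addrA.
  by split; [rewrite /derivable /= E; exact: df | rewrite /derive /= E].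
have dg y : derivable g y u.
  by apply: derivableB; [have [] := dshift y | exact: df].
have gE y : 'D_u g y = 'D_u f (y + s *: v) - 'D_u f y.
  rewrite deriveB; [|by have [] := dshift y|exact: df].
  by have [_ ->] := dshift y.
have [c cs gc] := @MVT_along_line _ _ g x u s s0 dg.
have [d ds hd] := @MVT_along_line _ _ (fun z => 'D_u f z) (x + c *: u) v s s0 ddf.
exists c, d; split; [exact: cs | exact: ds |].
have gvE y : g y = f (y + s *: v) - f y by [].
by rewrite [in RHS]addrA expr2 -mulrA -hd -gE -gc !gvE opprB; ring.
Qed.

(** The second difference of f is symmetric in u and v, so each mixed derivative takes a common
    value at some point near x; continuity at x carries the equality over to x. *)
Lemma mixed_derive_sym (R : realType) (V : normedModType R) (f : V -> R)
    (x u v : V) :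
  (forall y, derivable f y u) -> (forall y, derivable f y v) ->
  (forall y, derivable (fun z => 'D_u f z) y v) ->
  (forall y, derivable (fun z => 'D_v f z) y u) ->
  {for x, continuous (fun y => 'D_v (fun z => 'D_u f z) y)} ->
  {for x, continuous (fun y => 'D_u (fun z => 'D_v f z) y)} ->
  'D_v (fun z => 'D_u f z) x = 'D_u (fun z => 'D_v f z) x.
Proof.
move=> dfu dfv dfuv dfvu cuv cvu.
apply/eqP; rewrite -subr_eq0 -normr_le0; apply/ler_addgt0Pl => e e0.
rewrite addr0.
have e20 : 0 < e / 2 by rewrite divr_gt0.
have half_dist (p q l : R) : `|p - l| <= e / 2 -> `|q - l| <= e / 2 ->
    `|p - q| <= e.
  by rewrite !ler_norml => /andP[? ?] /andP[? ?]; lra.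
pose fuv y := 'D_v (fun z => 'D_u f z) y.
pose fvu y := 'D_u (fun z => 'D_v f z) y.
change (`|fuv x - fvu x| <= e).
have /cvgrPdist_le/(_ _ e20) near_uv : fuv y @[y --> x] --> fuv x by exact: cuv.
have /cvgrPdist_le/(_ _ e20) near_vu : fvu y @[y --> x] --> fvu x by exact: cvu.
have [r r0 near_x] := (nbhs_ballP _ _).1 (filterI near_uv near_vu).
(* For c, d < s, the norm of cu + dv is at most s(|u| + |v|) < r; the added 1 keeps the inequality
   strict and the denominator positive. *)
pose s := r / (`|u| + `|v| + 1).
have k0 : 0 < `|u| + `|v| + 1 by rewrite ltr_wpDl// addr_ge0.
have s0 : 0 < s by rewrite divr_gt0.
have ball_s (c d : R) : 0 < c < s -> 0 < d < s ->
    ball x r (x + (c *: u + d *: v)).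
  move=> /andP[c0 cs] /andP[d0 ds].
  rewrite -ball_normE /= opprD addrA subrr sub0r normrN.
  apply: le_lt_trans (ler_normD _ _) _.
  rewrite !normrZ !gtr0_norm//.
  have rE : s * (`|u| + `|v| + 1) = r by rewrite /s divfK// gt_eqF.
  have := ler_wpM2r (normr_ge0 u) (ltW cs).
  have := ler_wpM2r (normr_ge0 v) (ltW ds).
  lra.
have [c [d [cs ds E1]]] := @second_difference_MVT _ _ f x u v s s0 dfu dfuv.
have [c' [d' [cs' ds' E2]]] := @second_difference_MVT _ _ f x v u s s0 dfv dfvu.
have {}E1 : _ = s ^+ 2 * fuv (x + (c *: u + d *: v)) := E1.
have {}E2 : _ = s ^+ 2 * fvu (x + (c' *: v + d' *: u)) := E2.
have fuv_fvu : fuv (x + (c *: u + d *: v)) = fvu (x + (c' *: v + d' *: u)).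
  have s20 : s ^+ 2 != 0 by rewrite expf_neq0// gt_eqF.
  move: E1 E2; move: (fuv _) (fvu _) => p q E1 E2.
  apply: (mulfI s20); rewrite -E1 -E2 (addrAC x (s *: v)).
  by rewrite (addrAC (f _)).
have [/= uvP _] := near_x _ (ball_s _ _ cs ds).
have [/= _ vuP] := near_x _ (ball_s _ _ ds' cs').
rewrite fuv_fvu in uvP; rewrite [d' *: u + _]addrC in vuP.
exact: half_dist uvP vuP.
Qed.

Lemma lipschitz_continuous (R : realType) (V W : normedModType R) (f : V -> W) :
  lipschitz f -> continuous f.
Proof.
move=> [k [kreal klip]] x; apply/cvgrPdist_lt => e e0.
(* The Lipschitz bound holds for every constant above [k], so a positive one can be chosen. *)
pose c := Num.max k 0 + 1.
have c0 : 0 < c by rewrite ltr_wpDl// le_max lexx orbT.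
have kc : k < c by rewrite ltr_pwDr// le_max lexx.
near=> y; apply: (@le_lt_trans _ _ (c * `|x - y|)).
  by have := klip _ kc (x, y); apply.
rewrite mulrC -ltr_pdivlMr//; near: y.
apply: cvgr_dist_lt; first exact: cvg_id.
by rewrite divr_gt0.
Unshelve. all: by end_near.
Qed.

(** Equality of mixed derivatives needs them to exist everywhere and to be continuous at x:
    differentiability of the gradient gives the former, the Lipschitz Hessian the latter. *)
Lemma hess_sym (R : realType) (n : nat) (f : 'cV[R]_n -> R) (x : 'cV[R]_n) :
  twice_differentiable f -> lipschitz_hess f -> (hess f x)^T = hess f x.
Proof.
move=> [df ddf] Lf; apply/matrixP => i j; rewrite !mxE.
have dgrad y k v : derivable (fun z => 'D_(basis_vec R k) f z) y v.
  have dg : derivable (grad f) y v by exact: diff_derivable.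
  have := (derivable_mxP _ _ _).1 dg k 0.
  have -> : (fun z => grad f z k 0) = 'D_(basis_vec R k) f.
    by apply/funext => z; rewrite mxE.
  by [].
have chess k l :
    continuous (fun y => 'D_(basis_vec R l) (fun z => 'D_(basis_vec R k) f z) y).
  move=> y; have -> : (fun y => 'D_(basis_vec R l)
      (fun z => 'D_(basis_vec R k) f z) y) = (fun A : 'M[R]_n => A k l) \o hess f.
    by apply/funext => z /=; rewrite mxE.
  apply: continuous_comp; first exact: lipschitz_continuous.
  exact: coord_continuous.
have df' y v : derivable f y v by exact: diff_derivable.
exact: mixed_derive_sym (df' ^~ _) (df' ^~ _) (dgrad ^~ _ ^~ _) (dgrad ^~ _ ^~ _)
  (chess _ _ x) (chess _ _ x).
Qed.

(** * Existence of the outer minimum *)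

Section VectorContinuity.
Context {R : realType} {T : topologicalType}.
Implicit Type n : nat.

Lemma continuous_sumr (I : Type) (r : seq I) (f : I -> T -> R) :
  (forall i, continuous (f i)) -> continuous (fun x => \sum_(i <- r) f i x).
Proof. by move=> cf; apply: continuous_big => //; exact: add_continuous. Qed.

Lemma continuous_dot n (f g : T -> 'cV[R]_n) :
  (forall i, continuous (fun x => f x i 0)) ->
  (forall i, continuous (fun x => g x i 0)) ->
  continuous (fun x => dot (f x) (g x)).
Proof.
by move=> cf cg; apply: continuous_sumr => i x; apply: continuousM;
  [exact: cf | exact: cg].
Qed.

Lemma continuous_enorm n (f : T -> 'cV[R]_n) :
  (forall i, continuous (fun x => f x i 0)) ->
  continuous (fun x => enorm (f x)).
Proof.
move=> cf x; apply: (@continuous_comp _ _ _ (fun x => dot (f x) (f x)) Num.sqrt).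
  exact: continuous_dot.
exact: sqrt_continuous.
Qed.

Lemma continuous_mulmx n m (A : 'M[R]_(m, n)) (f : T -> 'cV[R]_n) i :
  (forall j, continuous (fun x => f x j 0)) ->
  continuous (fun x => (A *m f x) i 0).
Proof.
move=> cf; under eq_fun do rewrite mxE.
by apply: continuous_sumr => j x; apply: continuousM;
  [exact: cst_continuous | exact: cf].
Qed.

End VectorContinuity.

(** The box [-r, r]^n is compact and contains the Euclidean ball of radius r; beyond that ball 0
    does at least as well, and 0 lies in the box. Row vectors appear because [rV_compact] concerns
    them. *)
Lemma coercive_min (R : realType) (n : nat) (f : 'cV[R]_n -> R) (r : R) :
  0 <= r -> continuous (fun v : 'rV[R]_n => f v^T) ->
  (forall d, r < enorm d -> f 0 <= f d) ->
  exists d0, forall d, f d0 <= f d.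
Proof.
move=> r0 cf coerc.
pose K := [set v : 'rV[R]_n | forall i, `[- r, r]%classic (v 0 i)].
have K0 : K 0 by move=> i; rewrite mxE /= in_itv/= oppr_le0 r0.
have [|||c _ cmin] := @compact_EVT_min _ _ (fun v : 'rV[R]_n => f v^T) K.
- by exists 0.
- by apply: (@rV_compact _ _ (fun=> `[- r, r]%classic)) => i; exact: segment_compact.
- exact: continuous_subspaceT.
exists c^T => d.
have [dr|/coerc] := leP (enorm d) r; last first.
  by apply: le_trans; rewrite -(trmx0 R) cmin// inE.
rewrite -[d]trmxK cmin// inE => i /=; rewrite mxE in_itv/= -ler_norml.
exact: le_trans (entry_le_enorm _ _) dr.
Qed.

Definition quad (R : realType) (n : nat) (H : 'M[R]_n) (g d : 'cV[R]_n) : R :=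
  dot g d + 1 / 2 * dot (H *m d) d.

Section Quad.
Context {R : realType} {n : nat}.
Implicit Types (H : 'M[R]_n) (g d e : 'cV[R]_n).

Lemma quad0 H g : quad H g 0 = 0.
Proof. by rewrite /quad mulmx0 !dot0l dot0r mulr0 addr0. Qed.

Lemma continuous_quad (T : topologicalType) H g (f : T -> 'cV[R]_n) :
  (forall i, continuous (fun x => f x i 0)) ->
  continuous (fun x => quad H g (f x)).
Proof.
move=> cf x; rewrite /quad; apply: cvgD.
  by apply: continuous_dot => // i y; exact: cst_continuous.
apply: cvgM; first exact: cvg_cst.
apply: (@continuous_dot _ _ _ (fun y => H *m f y) f) => // i.
exact: continuous_mulmx.
Qed.

Lemma quad_shift_scalar H g d (k : R) :
  quad (H + (k / 2)%:M) g d = quad H g d + k / 4 * enorm d ^+ 2.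
Proof.
rewrite /quad mulmxDl dotDl mul_scalar_mx dotZl sqr_enorm.
by field.
Qed.

Lemma quad_translate H g d e : H^T = H ->
  quad H g (d + e) = quad H g d + dot (H *m d + g) e + 1 / 2 * dot (H *m e) e.
Proof.
move=> Hsym; rewrite /quad mulmxDr !dotDl !dotDr.
have -> : dot (H *m e) d = dot (H *m d) e by rewrite dot_mulmx Hsym dotC.
by field.
Qed.

Lemma quad_critical H g : H \in unitmx ->
  quad H g (- (invmx H *m g)) = - (1 / 2 * dot (invmx H *m g) g).
Proof.
move=> Hu; rewrite /quad mulmxN mulKVmx// dotNl !dotNr (dotC g).
by field.
Qed.

Lemma quad_ge_critical H g d : H^T = H -> pdmx H ->
  - (1 / 2 * dot (invmx H *m g) g) <= quad H g d.
Proof.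
move=> Hsym Hpd; have Hu := pdmx_unit Hpd.
(* Expanded around the critical point, [quad] loses its linear term, and the remainder is half the
   nonnegative form of H. *)
rewrite -[d](subrK (- (invmx H *m g))) addrC quad_translate// quad_critical//.
rewrite mulmxN mulKVmx// addNr dot0l addr0 lerDl mulr_ge0//.
exact: pdmx_psdmx.
Qed.

End Quad.

(** The norm term and the form of B are nonnegative, so only -|b||d| pulls the objective down, and
    the cubic term dominates it. With [c] the vector of Taylor models, this objective is the inner
    maximum over the unit ball. *)
Lemma regularized_norm_min (R : realType) (n m : nat)
    (c : 'cV[R]_n -> 'cV[R]_m) (B : 'M[R]_n) (b : 'cV[R]_n) (M : R) :
  0 < M -> psdmx B ->
  (forall i, continuous (fun v : 'rV[R]_n => c v^T i 0)) ->
  exists d0, forall d,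
    enorm (c d0) + quad B b d0 + M / 6 * enorm d0 ^+ 3
    <= enorm (c d) + quad B b d + M / 6 * enorm d ^+ 3.
Proof.
move=> M0 Bpsd cc.
pose f d := enorm (c d) + quad B b d + M / 6 * enorm d ^+ 3.
pose k := enorm b + enorm (c 0).
have k0 : 0 <= k by rewrite addr_ge0 ?enorm_ge0.
(* Beyond this radius |d| >= 1 and (M/6)|d| >= k, so (M/6)|d|^3 >= k|d|^2 >= |b||d| + |c(0)|, and
   the value at d is at least |c(0)|, the value at 0. *)
apply: (@coercive_min _ _ f (1 + 6 * k / M)).
- by rewrite addr_ge0// divr_ge0 ?mulr_ge0// ltW.
- have ct (i : 'I_n) : continuous (fun v : 'rV[R]_n => v^T i 0).
    by under eq_fun do rewrite mxE; exact: coord_continuous.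
  have cX : continuous (fun v : 'rV[R]_n => enorm v^T ^+ 3).
    move=> v; apply: (@continuous_comp _ _ _ (fun v : 'rV[R]_n => enorm v^T)
      (fun x : R => x ^+ 3)); first exact: continuous_enorm.
    exact: exprn_continuous.
  have cq := continuous_quad (H := B) (g := b) ct.
  move=> v; exact: (cvgD (cvgD (continuous_enorm cc (x := v)) (cq v))
    (cvgM (cvg_cst _) (cX v))).
move=> d; rewrite /f quad0 addr0 enorm0 expr0n/= mulr0 addr0.
have cd := enorm_ge0 (c d).
have qd : - (enorm b * enorm d) <= quad B b d.
  rewrite /quad -[leLHS]addr0 lerD//; last by rewrite mulr_ge0.
  by rewrite -enormN lerNl -dotNl cauchy_schwarz.
move: qd cd k0; rewrite /k; move: (enorm_ge0 (c 0)) (enorm_ge0 b).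
move: (enorm d) (enorm b) (enorm (c 0)) (enorm (c d)) (quad B b d).
move=> x p q y z q0 p0 qd y0 _ hx.
have qM : 0 <= 6 * (p + q) / M by rewrite divr_ge0 ?(ltW M0)// mulr_ge0 ?addr_ge0.
have x1 : 1 <= x by apply: le_trans (ltW hx); rewrite lerDl.
have Mx : p + q <= M / 6 * x.
  have : 6 * (p + q) / M <= x by lra.
  by rewrite ler_pdivrMr//; lra.
have : (p + q) * (x * x) <= M / 6 * x * (x * x).
  by rewrite ler_wpM2r// mulr_ge0//; lra.
have : (p + q) * (x * 1) <= (p + q) * (x * x).
  by rewrite ler_wpM2l ?addr_ge0// ler_wpM2l//; lra.
have : q * 1 <= q * x by rewrite ler_wpM2l.
rewrite !exprS expr0; lra.
Qed.

(** * Duality *)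

(** Division by t leaves D <= tC for arbitrarily small t > 0. This turns second-order error
    estimates into first-order optimality conditions. *)
Lemma slope_le0 (R : realType) (D C t0 : R) : 0 < t0 ->
  (forall t, 0 < t <= t0 -> t * D <= t ^+ 2 * C) -> D <= 0.
Proof.
move=> t00 DC; rewrite leNgt; apply/negP => D0.
have C0 : 0 < `|C| + 1 by rewrite ltr_wpDl.
(* The second bound makes tC <= t(|C| + 1) <= D/2 < D. *)
pose t := Num.min t0 (D / (2 * (`|C| + 1))).
have t_gt0 : 0 < t by rewrite lt_min t00 divr_gt0// mulr_gt0.
have := DC t; rewrite t_gt0 ge_min lexx => /(_ isT).
rewrite expr2 -mulrA ler_pM2l// => DtC.
have : t * C <= t * (`|C| + 1).
  by rewrite ler_pM2l// (le_trans (ler_norm C))// lerDl.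
have : t * (`|C| + 1) <= D / 2.
  have : t <= D / (2 * (`|C| + 1)) by rewrite ge_min lexx orbT.
  by rewrite ler_pdivlMr ?mulr_gt0//; lra.
lra.
Qed.

Section Duality.
Context {R : realType} {n m : nat}.
Variables (F : 'cV[R]_n -> 'cV[R]_m) (B : 'M[R]_n) (a xk : 'cV[R]_n) (M : R).
Hypothesis M0 : 0 < M.
Implicit Types (x d : 'cV[R]_n) (u : 'cV[R]_m) (w : R).

Local Notation b := (a + B *m xk).
Local Notation H := (Hk F B xk).
Local Notation G := (Gk F B a xk).
Local Notation step u w := (- (invmx (H u w) *m G u)).

Definition taylor2 (d : 'cV[R]_n) : 'cV[R]_m :=
  \col_i (component F i xk
          + quad (hess (component F i) xk) (grad (component F i) xk) d).

(* theta_k with its cubic term replaced by the minorant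
   M/6 r^3 >= w/4 r^2 - w^3/(12 M^2), an equality at r = w/M;
   minimizing over d yields beta_k. *)
Definition lagrangian (u : 'cV[R]_m) (w : R) (d : 'cV[R]_n) : R :=
  dot u (taylor2 d) + quad B b d + w / 4 * enorm d ^+ 2
  - 1 / (12 * M ^+ 2) * w ^+ 3.

(** The left side shows linear dependence on u, for maximizing over the ball; the right side is a
    single quadratic in d, for minimizing over d. *)
Lemma dot_taylor2 u d :
  dot u (taylor2 d) + quad B b d
    = lk F xk u + quad (Ak F B xk u) (G u) d.
Proof.
rewrite /quad /Ak /Gk mulmxDl mulmx_suml !dotDl !dot_suml.
have -> : dot u (taylor2 d) = lk F xk u
    + \sum_i dot (u i 0 *: grad (component F i) xk) d
    + 1 / 2 * \sum_i dot (u i 0 *: hess (component F i) xk *m d) d.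
  rewrite /lk mulr_sumr -!big_split /=; apply: eq_bigr => i _.
  by rewrite mxE /quad dotZl -scalemxAl dotZl; ring.
by ring.
Qed.

Lemma thetakE x u :
  thetak F B a M xk x u = dot u (taylor2 (x - xk)) + quad B b (x - xk)
                          + M / 6 * enorm (x - xk) ^+ 3.
Proof. by rewrite dot_taylor2 /quad /thetak addrA. Qed.

Lemma lagrangianE u w d :
  lagrangian u w d = lk F xk u + quad (H u w) (G u) d
                     - 1 / (12 * M ^+ 2) * w ^+ 3.
Proof. by rewrite /lagrangian dot_taylor2 /Hk quad_shift_scalar !addrA. Qed.

Lemma betakE u w : pdmx (H u w) ->
  betak F B a M xk u w = lagrangian u w (step u w).
Proof.
by move=> Hpd; rewrite lagrangianE quad_critical ?pdmx_unit.
Qed.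

(** With r = |x - x_k| and s = w/M, the difference is (M/12)(2r^3 - 3sr^2 + s^3), a cubic with
    double root r = s. *)
Lemma thetak_sub_lagrangian x u w :
  thetak F B a M xk x u - lagrangian u w (x - xk)
  = M / 12 * (w / M + 2 * enorm (x - xk)) * (enorm (x - xk) - w / M) ^+ 2.
Proof.
by rewrite thetakE /lagrangian; field; rewrite gt_eqF.
Qed.

Lemma lagrangian_le_thetak x u w : 0 <= w ->
  lagrangian u w (x - xk) <= thetak F B a M xk x u.
Proof.
move=> w0; rewrite -subr_ge0 thetak_sub_lagrangian mulr_ge0 ?sqr_ge0//.
rewrite mulr_ge0 ?addr_ge0 ?divr_ge0 ?(ltW M0)//.
by rewrite mulr_ge0 ?enorm_ge0.
Qed.

Hypothesis Hsym : forall u w, (H u w)^T = H u w.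

Lemma betak_le_lagrangian u w d : pdmx (H u w) ->
  betak F B a M xk u w <= lagrangian u w d.
Proof.
move=> Hpd; rewrite lagrangianE /betak lerD2r lerD2l.
exact: quad_ge_critical.
Qed.

Lemma Hk_convex u u' w w' t :
  H ((1 - t) *: u + t *: u') ((1 - t) * w + t * w')
  = (1 - t) *: H u w + t *: H u' w'.
Proof.
rewrite /Hk /Ak !scalerDr !scaler_sumr.
have -> : \sum_i ((1 - t) *: u + t *: u') i 0 *: hess (component F i) xk
    = \sum_i (1 - t) *: (u i 0 *: hess (component F i) xk)
      + \sum_i t *: (u' i 0 *: hess (component F i) xk).
  rewrite -big_split /=; apply: eq_bigr => i _.
  by rewrite !mxE !scalerA -scalerDl.
rewrite !scale_scalar_mx mulrDl -!mulrA raddfD/=.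
rewrite [RHS]addrACA [X in _ = X + _]addrACA.
by rewrite -(scalerDl B) subrK scale1r.
Qed.

Lemma Gk_convex u u' t :
  G ((1 - t) *: u + t *: u') = (1 - t) *: G u + t *: G u'.
Proof.
rewrite /Gk !scalerDr !scaler_sumr.
have -> : \sum_i ((1 - t) *: u + t *: u') i 0 *: grad (component F i) xk
    = \sum_i (1 - t) *: (u i 0 *: grad (component F i) xk)
      + \sum_i t *: (u' i 0 *: grad (component F i) xk).
  rewrite -big_split /=; apply: eq_bigr => i _.
  by rewrite !mxE !scalerA -scalerDl.
rewrite [RHS]addrACA [X in _ = X + _]addrACA.
by rewrite -(scalerDl a) -(scalerDl (B *m xk)) !subrK !scale1r.
Qed.

(* Since (1-t) H + t H' stays uniformly positive definite for small t, moving
   the feasible point by t moves the minimizer of the Lagrangian by O(t), so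
   beta_k changes by t times the partial derivative of the Lagrangian at the
   fixed step, up to O(t^2). *)
Lemma betak_first_order u w u' w' :
  Fk F B xk (u, w) -> enorm u' <= 1 -> 0 <= w' ->
  (forall p, Fk F B xk p ->
     betak F B a M xk p.1 p.2 <= betak F B a M xk u w) ->
  dot (u' - u) (taylor2 (step u w))
  + (w' - w) / 4 * (enorm (step u w) ^+ 2 - (w / M) ^+ 2) <= 0.
Proof.
move=> [/= w0 u1 Hpd] u'1 w'0 bmax.
have [e e0 He] := pdmx_coercive (Hsym u w) Hpd.
have [k k0 Hk'] := quadform_bound (H u' w').
(* The gradient in d of the model for (u, w) vanishes at [d], so the model for the mixed point has
   gradient tz there. *)
pose d := step u w; pose z := H u' w' *m d + G u'.
(* [C] collects the errors of order t^2: the first term from re-minimizing over d, the second from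
   expanding the cube of [wt]. *)
pose C := dot z z / e
  + 1 / (12 * M ^+ 2) * (3 * w * (w' - w) ^+ 2 + `|w' - w| ^+ 3).
have ek0 : 0 < 2 * (e + k) by rewrite mulr_gt0// ltr_wpDr.
(* For such t, (1 - t)e - tk >= e/2, so the mixed matrix stays coercive with constant e/2. *)
apply: (@slope_le0 _ _ C (e / (2 * (e + k)))); first by rewrite divr_gt0.
move=> t /andP[t0]; rewrite ler_pdivlMr// => tek.
have tk : 0 <= t * k by rewrite mulr_ge0// ltW.
have t1 : t <= 1.
  by rewrite -(ler_pM2r e0); lra.
pose ut := (1 - t) *: u + t *: u'; pose wt := (1 - t) * w + t * w'.
have Ht_coercive v : e / 2 * dot v v <= dot (H ut wt *m v) v.
  rewrite Hk_convex mulmxDl -!scalemxAl dotDl !dotZl.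
  have := Hk' v; rewrite ler_norml => /andP[+ _].
  move/(ler_wpM2l (ltW t0)) => h1; have := He v.
  have t10 : 0 <= 1 - t by rewrite subr_ge0.
  move/(ler_wpM2l t10) => h2.
  have := ler_wpM2r (dot_ge0 v) tek; lra.
have Ht_pd : pdmx (H ut wt).
  move=> v vN0; apply: lt_le_trans (Ht_coercive v).
  by rewrite mulr_gt0 ?divr_gt0// lt0r dot_eq0 vN0 dot_ge0.
have pt_feasible : Fk F B xk (ut, wt).
  split=> //=; first by rewrite addr_ge0 ?mulr_ge0 ?subr_ge0// ltW.
  by rewrite enorm_convex_le1// (ltW t0).
have := bmax _ pt_feasible; rewrite /= !betakE// -/d.
pose s := step ut wt - d.
have -> : step ut wt = d + s by rewrite addrC subrK.
rewrite lagrangianE quad_translate//.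
have -> : H ut wt *m d + G ut = t *: z.
  rewrite Hk_convex Gk_convex mulmxDl -!scalemxAl addrACA -!scalerDr.
  by rewrite /d mulmxN mulKVmx ?pdmx_unit// addNr scaler0 add0r.
(* Coercivity and Young's inequality: shifting the minimizer by any [s] lowers the Lagrangian by at
   most t^2|z|^2/e. *)
have Cs : - (t ^+ 2 * (dot z z / e)) <= dot (t *: z) s + 1 / 2 * dot (H ut wt *m s) s.
  by rewrite dotZl; have := Ht_coercive s; have := young_dot t z s e0; lra.
have wcube : wt ^+ 3 <= w ^+ 3 + 3 * t * w ^+ 2 * (w' - w)
    + t ^+ 2 * (3 * w * (w' - w) ^+ 2 + `|w' - w| ^+ 3).
  have : t * (w' - w) ^+ 3 <= `|w' - w| ^+ 3.
    apply: le_trans (ler_norm _) _; rewrite normrM normrX ger0_norm ?(ltW t0)//.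
    by rewrite ler_piMl// exprn_ge0.
  move/(ler_wpM2l (sqr_ge0 t)) => h.
  have -> : wt ^+ 3 = w ^+ 3 + 3 * t * w ^+ 2 * (w' - w)
    + t ^+ 2 * (3 * w * (w' - w) ^+ 2) + t ^+ 2 * (t * (w' - w) ^+ 3).
    by rewrite /wt; ring.
  lra.
have M20 : 0 < 1 / (12 * M ^+ 2) by rewrite divr_gt0// mulr_gt0 ?exprn_gt0.
rewrite -(ler_pM2l M20) in wcube.
have : lagrangian ut wt d = lagrangian u w d
    + t * (dot (u' - u) (taylor2 d) + (w' - w) / 4 * enorm d ^+ 2)
    - 1 / (12 * M ^+ 2) * (wt ^+ 3 - w ^+ 3).
  rewrite /lagrangian /ut {1}/wt !dotDl !dotZl dotNl.
  by field; rewrite gt_eqF.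
rewrite lagrangianE => lagt bt.
(* The factor of w' - w is the derivative in w of (w/4)|d|^2 - w^3/(12M^2). *)
have -> : (w' - w) / 4 * (enorm d ^+ 2 - (w / M) ^+ 2)
  = (w' - w) / 4 * enorm d ^+ 2 - 1 / (12 * M ^+ 2) * (3 * w ^+ 2 * (w' - w)).
  by field; rewrite gt_eqF.
rewrite /C; lra.
Qed.

End Duality.

(** * Inner maximum over the unit ball and the min-max identity *)

Lemma is_maximum_dot_ball (R : realType) (m : nat) (c : 'cV[R]_m) (k : R) :
  is_maximum [set u : 'cV[R]_m | enorm u <= 1] (fun u => dot u c + k)
    (enorm c + k).
Proof.
split; last first.
  move=> _ [u /= u1 <-]; rewrite lerD2r; apply: le_trans (cauchy_schwarz _ _) _.
  by rewrite ler_piMl ?enorm_ge0.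
have [->|cN0] := eqVneq c 0.
  by exists 0; rewrite /= ?enorm0 ?ler01// dot0r.
have cN0' : enorm c != 0 by rewrite enorm_eq0.
exists ((enorm c)^-1 *: c); rewrite /= ?enorm_le// ?dotZl ?dotZr -sqr_enorm.
  by rewrite expr1n le_eqVlt; apply/orP; left; apply/eqP; field.
by congr (_ + k); field.
Qed.

Unset Implicit Arguments.

Theorem theorem5p1 (R : realType) (n m : nat)
    (F : 'cV[R]_n -> 'cV[R]_m) (B : 'M[R]_n) (a : 'cV[R]_n)
    (hF2 : forall i : 'I_m, twice_differentiable (component F i))
    (hFL : forall i : 'I_m, lipschitz_hess (component F i))
    (hBsym : B^T = B) (hBpsd : psdmx B)
    (M : R) (xk : 'cV[R]_n) (hM : 0 < M) :
  (exists thetastar : R,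
     is_minmax [set: 'cV[R]_n] [set u : 'cV[R]_m | enorm u <= 1]
       (thetak F B a M xk) thetastar
     /\ (forall betastar : R,
           is_maximum (Fk F B xk) (fun p => betak F B a M xk p.1 p.2) betastar ->
           thetastar = betastar))
  /\
  (forall (u : 'cV[R]_m) (w : R), Fk F B xk (u, w) ->
     let xk1 := xk - invmx (Hk F B xk u w) *m Gk F B a xk u in
     let rk := enorm (xk1 - xk) in
     0 <= thetak F B a M xk xk1 u - betak F B a M xk u w
     /\ thetak F B a M xk xk1 u - betak F B a M xk u w
        = M / 12 * (w / M + 2 * rk) * (rk - w / M) ^+ 2).
Proof.
have Hsym u w : (Hk F B xk u w)^T = Hk F B xk u w.
  rewrite /Hk /Ak !linearD /= tr_scalar_mx hBsym linear_sum /=.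
  congr (_ + _ + _); apply: eq_bigr => i _.
  by rewrite linearZ /= hess_sym.
split; last first.
  move=> u w uwF xk1 rk; have [/= w0 _ Hpd] := uwF.
  have xk1E : xk1 - xk = - (invmx (Hk F B xk u w) *m Gk F B a xk u).
    by rewrite /xk1 addrAC subrr add0r.
  have gapE : thetak F B a M xk xk1 u - betak F B a M xk u w
      = M / 12 * (w / M + 2 * rk) * (rk - w / M) ^+ 2.
    (* The new step minimizes the Lagrangian, so beta_k is the Lagrangian at that same step and the
       gap is the cubic identity. *)
    by rewrite betakE// -xk1E thetak_sub_lagrangian.
  split=> //; rewrite gapE mulr_ge0 ?sqr_ge0// mulr_ge0 ?divr_ge0 ?(ltW hM)//.
  by rewrite addr_ge0 ?divr_ge0 ?(ltW hM)// mulr_ge0 ?enorm_ge0.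
pose c := taylor2 F xk; pose b := a + B *m xk.
have cc i : continuous (fun v : 'rV[R]_n => c v^T i 0).
  have -> : (fun v : 'rV[R]_n => c v^T i 0) = fun v => component F i xk
      + quad (hess (component F i) xk) (grad (component F i) xk) v^T.
    by apply/funext => v; rewrite mxE.
  have cT (j : 'I_n) : continuous (fun v : 'rV[R]_n => v^T j 0).
    by under eq_fun do rewrite mxE; exact: coord_continuous.
  move=> v; exact: (cvgD (cvg_cst _) (continuous_quad cT (x := v))).
have [d0 d0min] := regularized_norm_min b hM hBpsd cc.
(* Since theta_k is affine in u, its maximum over the unit ball is the norm of the Taylor vector
   plus the terms free of u. *)
pose phi x := enorm (c (x - xk)) + (quad B b (x - xk) + M / 6 * enorm (x - xk) ^+ 3).
have phiP x : is_maximum [set u : 'cV[R]_m | enorm u <= 1]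
    (thetak F B a M xk x) (phi x).
  have -> : thetak F B a M xk x = fun u => dot u (c (x - xk))
      + (quad B b (x - xk) + M / 6 * enorm (x - xk) ^+ 3).
    by apply/funext => u; rewrite thetakE -addrA.
  exact: is_maximum_dot_ball.
have xkK d : xk + d - xk = d by rewrite addrC addKr.
have phi_min x : phi (xk + d0) <= phi x.
  rewrite /phi xkK.
  by have := d0min (x - xk); rewrite -!(addrA _ (quad _ _ _)).
exists (phi (xk + d0)); split.
  exists phi; split=> [x _|]; first exact: phiP.
  by split=> [|_ [x _ <-]]; [exists (xk + d0) | exact: phi_min].
move=> _ [[[u w] /= uwF <-] bub].
have [w0 u1 Hpd] := uwF.
apply/eqP; rewrite eq_le; apply/andP; split; last first.
  (* Weak duality at the outer minimizer: phi >= theta_k(., u) >= Lagrangian >= beta_k(u, w). *)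
  have [_ ub] := phiP (xk + d0); apply: le_trans (ub _ _); last first.
    by exists u.
  apply: le_trans (lagrangian_le_thetak F B a xk hM _ u w0).
  exact: betak_le_lagrangian.
pose d := - (invmx (Hk F B xk u w) *m Gk F B a xk u).
have foc u' w' (u'1 : enorm u' <= 1) (w'0 : 0 <= w') :
    dot (u' - u) (c d) + (w' - w) / 4 * (enorm d ^+ 2 - (w / M) ^+ 2) <= 0.
  by apply: betak_first_order => // p pF; apply: bub; exists p.
have r0 := enorm_ge0 d.
have wM0 : 0 <= w / M by rewrite divr_ge0// ltW.
(* Raising w by 1 yields |d| <= w/M. Lowering w to 0 yields the converse when w > 0; for w = 0 the
   converse is trivial. *)
have rE : enorm d = w / M.
  apply/eqP; rewrite -(eqrXn2 (_ : 0 < 2)%N)// eq_le; apply/andP; split.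
    have := foc u (w + 1) u1 (addr_ge0 w0 ler01).
    by rewrite subrr dot0l add0r addrC addKr; lra.
  have [w_eq0|wN0] := eqVneq w 0.
    by rewrite w_eq0 mul0r expr0n/= sqr_ge0.
  have w_gt0 : 0 < w by rewrite lt0r wN0.
  have := foc u 0 u1 (lexx 0).
  rewrite subrr dot0l add0r sub0r mulNr mulNr oppr_le0 pmulr_rge0 ?divr_gt0//.
  by rewrite subr_ge0.
apply: le_trans (phi_min (xk + d)) _.
have [[u' /= u'1 <-] _] := phiP (xk + d).
(* As |d| = w/M, the gap formula gives zero; the condition in u with w fixed then says that the
   maximizer u' at x_k + d does no better than u. *)
have -> : betak F B a M xk u w = thetak F B a M xk (xk + d) u.
  apply/esym/eqP; rewrite -subr_eq0 betakE// -/d -{2}(xkK d) thetak_sub_lagrangian//.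
  by rewrite xkK rE subrr expr0n/= mulr0.
rewrite !thetakE xkK !lerD2r -subr_le0 -dotNl -dotDl.
by have := foc u' w u'1 w0; rewrite subrr !mul0r addr0.
Qed.
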